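(* Let $G$ be a max stable df and let $F$ be a df with $\lim_{n\to\infty}F^n(a_nx+b_n)=G(x)$, $x\in\mathbb{R}$, for some $a_n>0$, $b_n\in\mathbb{R}$. Let $m\ge1$ be an integer, let $X_1,X_2,\dots$ be iid with df $F$, and for each $n$ let $N_n$ be independent of $X_1,X_2,\dots$ and shifted geometric: $P(N_n=r)=p_nq_n^{r-m}$, $r=m,m+1,m+2,\dots$, where $0<p_n<1$, $q_n=1-p_n$ and $\lim_{n\to\infty}np_n=1$. Then for every fixed integer $k$ with $1\le k\le m$ and every $x$ with $G(x)>0$, $$\lim_{n\to\infty}F_{k:N_n}(a_nx+b_n)=1-\left(\frac{-\ln G(x)}{1-\ln G(x)}\right)^k.$$
   Context: df means distribution function on $\mathbb{R}$. $F_{k:N_n}(x)=P(X_{N_n-k+1:N_n}\le x)=\sum_{r}\sum_{i=0}^{k-1}\binom{r}{i}F^{r-i}(x)(1-F(x))^iP(N_n=r)$ is the df of the $k$-th largest among $X_1,\dots,X_{N_n}$. A max stable df is a df of the form $x\mapsto G_0(Ax+B)$ with $A>0$, $B\in\mathbb{R}$ and $G_0$ one of: $\Phi_\alpha(x)=\exp(-x^{-\alpha})$ for $x>0$ and $0$ for $x\le 0$; $\Psi_\alpha(x)=\exp(-|x|^{\alpha})$ for $x<0$ and $1$ for $x\ge 0$ ($\alpha>0$); $\Lambda(x)=\exp(-e^{-x})$. *)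

(* Defs.v *)
From HB Require Import structures.
From mathcomp Require Import all_boot all_order all_algebra finmap.
From mathcomp Require Import all_classical all_reals all_analysis.

Set Implicit Arguments.
Unset Strict Implicit.
Unset Printing Implicit Defensive.

Import Order.TTheory GRing.Theory Num.Theory.
Import numFieldNormedType.Exports.

Local Open Scope classical_set_scope.
Local Open Scope ring_scope.

Definition frechet_df (R : realType) (alpha x : R) : R :=
  if 0 < x then expR (- (x `^ (- alpha))) else 0.

Definition weibull_df (R : realType) (alpha x : R) : R :=
  if x < 0 then expR (- (`|x| `^ alpha)) else 1.

Definition gumbel_df (R : realType) (x : R) : R := expR (- expR (- x)).

Definition standard_max_stable (R : realType) (G0 : R -> R) : Prop :=
  [\/ exists2 alpha : R, 0 < alpha & G0 = frechet_df alpha,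
      exists2 alpha : R, 0 < alpha & G0 = weibull_df alpha
    | G0 = @gumbel_df R].

Definition max_stable (R : realType) (G : R -> R) : Prop :=
  exists G0 : R -> R, exists A B : R,
    [/\ standard_max_stable G0, 0 < A & forall x, G x = G0 (A * x + B)].

Section Independence.
Context d d' d'' (T : measurableType d) (T' : measurableType d')
  (T'' : measurableType d'') (R : realType) (P : probability T R).

Definition mutually_independent (I : choiceType) (X : I -> {RV P >-> T'}) :
    Prop :=
  forall (J : {fset I}) (A : I -> set T'), (forall i, measurable (A i)) ->
    P (\bigcap_(i in [set` J]) (X i @^-1` A i)) =
    (\big[*%E/1%E]_(i <- J) P (X i @^-1` A i))%E.

(* The sigma-algebra on T generated by the whole family X. *)
Definition sigma_family (I : Type) (X : I -> {RV P >-> T'}) : set (set T) :=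
  <<s \bigcup_i preimage_set_system setT (X i) measurable >>.

Definition independent_of_family (I : Type) (N : {RV P >-> T''})
    (X : I -> {RV P >-> T'}) : Prop :=
  forall (A : set T'') (B : set T), measurable A -> sigma_family X B ->
    P (N @^-1` A `&` B) = (P (N @^-1` A) * P B)%E.

End Independence.

(* order_stat X j n w is X_{j:n}(w), the j-th smallest (1 <= j <= n) of the
   first n terms of the sequence; X i stands for X_{i+1}. *)
Definition order_stat (T : Type) (R : realType) (X : nat -> T -> R)
    (j n : nat) (w : T) : R :=
  nth 0 (sort <=%R (mkseq (fun i => X i w) n)) j.-1.

(* The df F_{k:N} of X_{N-k+1:N} for a random sample size N.  On the event
   N < k the order statistic is undefined mathematically and takes a default
   value here; this event has probability 0 when N >= k almost surely. *)
Definition kth_largest_df d (T : measurableType d) (R : realType)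
    (P : probability T R) (X : nat -> T -> R) (N : T -> nat) (k : nat) (x : R) :
    \bar R :=
  P [set w | order_stat X (N w - k + 1) (N w) w <= x].

(* Main.v *)
(** The k-th largest of N observations is at most y iff fewer than k of the
    first N observations exceed y.  With t = P(X_1 > y), the number S_r of
    exceedances among the first r observations is binomial(r, t).  Write
    N = m + M with M geometric.  Splitting off the first m trials squeezes the
    probability between (1 - t)^m P(S_M < k) and P(S_M < k), and S_M is again
    geometric: P(S_M >= k) = theta^k with theta = q t / (p + q t).  For
    y = a_n x + b_n one has t -> 0 and n t -> - ln G(x), hence
    theta -> - ln G(x) / (1 - ln G(x)). *)
Require Import Defs.
From HB Require Import structures.
From mathcomp Require Import all_boot all_order all_algebra finmap.
From mathcomp Require Import all_classical all_reals all_analysis.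
From mathcomp Require Import ring lra.

Set Implicit Arguments.
Unset Strict Implicit.
Unset Printing Implicit Defensive.

Import Order.TTheory GRing.Theory Num.Theory.
Import numFieldNormedType.Exports.

Local Open Scope classical_set_scope.
Local Open Scope ring_scope.

(* P(S_r < k) for S_r binomial with parameters r and t. *)
Fixpoint binomial_lt (R : nzRingType) (t : R) (r k : nat) : R :=
  match r, k with
  | 0, _ => (0 < k)%N%:R
  | _.+1, 0 => 0
  | r'.+1, k'.+1 => (1 - t) * binomial_lt t r' k + t * binomial_lt t r' k'
  end.

(** * Binomial counts over a geometric number of trials *)

Section BinomialLt.
Variables (R : realType) (t : R).
Hypothesis t01 : 0 <= t <= 1.

Let B := binomial_lt t.

Lemma binomial_lt_ge0 r k : 0 <= B r k.
Proof.
have /andP[t0 t1] := t01.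
elim: r k => [|r IH] [|k]; rewrite /B /= ?ler01 //.
by apply: addr_ge0; apply: mulr_ge0; rewrite ?subr_ge0 // IH.
Qed.

Lemma binomial_lt_le1 r k : B r k <= 1.
Proof.
have /andP[t0 t1] := t01.
elim: r k => [|r IH] [|k] //; rewrite /B /= ?ler01 //.
rewrite -[leRHS](subrK t) lerD //.
  by rewrite ler_piMr ?subr_ge0 //; exact: IH.
by rewrite ler_piMr //; exact: IH.
Qed.

Lemma binomial_lt0 r : B r 0 = 0.
Proof. by case: r. Qed.

Lemma binomial_ltS r k : B r k <= B r k.+1.
Proof.
have /andP[t0 t1] := t01.
elim: r k => [|r IH] [|k] //; rewrite ?binomial_lt0 ?binomial_lt_ge0 //.
by rewrite /B /= lerD // ler_wpM2l ?subr_ge0 //; exact: IH.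
Qed.

(** The [m] additional trials can only add successes, which gives the upper bound. With probability
    [(1 - t) ^+ m] they all fail and leave the count unchanged, which gives the lower one. *)
Lemma binomial_lt_addl m r k :
  (1 - t) ^+ m * B r k <= B (m + r) k <= B r k.
Proof.
have /andP[t0 t1] := t01; have f0 : 0 <= 1 - t by rewrite subr_ge0.
elim: m => [|m /andP[lo hi]]; first by rewrite add0n expr0 mul1r lexx.
case: k lo hi => [|k] lo hi; first by rewrite !binomial_lt0 mulr0 lexx.
rewrite addSn /B /= -!/(B _ _); apply/andP; split.
  rewrite exprS -mulrA (le_trans (ler_wpM2l f0 lo)) // lerDl.
  by rewrite mulr_ge0 // binomial_lt_ge0.
apply: le_trans hi; have := ler_wpM2l t0 (binomial_ltS (m + r) k); lra.
Qed.

Variables (q : R).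
Hypothesis q01 : 0 < q < 1.

Let p := 1 - q.
(** Truncations of the series for P(S_M < k), with M geometric on 0, 1, 2, ... *)
Let S J k := \sum_(j < J) p * q ^+ j * B j k.

Lemma geom_sum J : \sum_(j < J) p * q ^+ j = 1 - q ^+ J.
Proof. by rewrite -mulr_sumr -opprB subrX1 /p; ring. Qed.

(* The number of successes among a geometric number of trials is geometric:
   conditioning on the first trial gives a recursion for its distribution. *)
Lemma cvg_geometric_binomial_lt k :
  S J k @[J --> \oo] --> 1 - (q * t / (p + q * t)) ^+ k.
Proof.
have /andP[t0 t1] := t01; have /andP[q0 q1] := q01.
have p0 : 0 < p by rewrite subr_gt0.
have pqt : p + q * t != 0 by rewrite gt_eqF// ltr_pwDl ?mulr_ge0 // ltW.
elim: k => [|k IH].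
  rewrite expr0 subrr (_ : S^~ 0%N = cst 0); first exact: cvg_cst.
  apply/funext => J; rewrite /S big1 // => j _.
  by rewrite binomial_lt0 mulr0.
(* The term [j = 0] equals [p], as no trials give no success; in the others [binomial_lt] unfolds
   once. *)
have SS J : S J.+1 k.+1 = p + q * (1 - t) * S J k.+1 + q * t * S J k.
  rewrite {1}/S big_ord_recl -addrA; congr (_ + _).
    by rewrite expr0 /B /= !mulr1.
  rewrite /S !mulr_sumr -big_split /=; apply: eq_bigr => j _.
  by rewrite /bump add1n exprS /B /=; ring.
(* The recursion determines the limit only once a limit is known to exist; the partial sums are
   monotone and at most 1. *)
have : cvgn (S^~ k.+1).
  apply: nondecreasing_is_cvgn.
    apply/nondecreasing_seqP => J; rewrite /S big_ord_recr lerDl /=.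
    by rewrite !mulr_ge0 ?exprn_ge0 ?binomial_lt_ge0 // ltW.
  exists 1 => _ [J _ <-]; apply: (@le_trans _ _ (\sum_(j < J) p * q ^+ j)).
    apply: ler_sum => j _; rewrite ler_piMr ?binomial_lt_le1 //.
    by rewrite mulr_ge0 ?exprn_ge0 // ltW.
  by rewrite geom_sum gerBl exprn_ge0 // ltW.
move=> /cvg_ex[L SL].
suff <- : L = 1 - (q * t / (p + q * t)) ^+ k.+1 by [].
have SL' : S J.+1 k.+1 @[J --> \oo] --> L.
  by have := SL; rewrite -[X in X -> _]cvg_shiftS.
have : S J.+1 k.+1 @[J --> \oo] --> p + q * (1 - t) * L +
    q * t * (1 - (q * t / (p + q * t)) ^+ k).
  under eq_fun do rewrite SS.
  by apply: cvgD; [apply: cvgD; [exact: cvg_cst|exact: cvgMl_tmp]|exact: cvgMl_tmp].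
move=> /(cvg_unique _ SL') => /(_ (@Rhausdorff R)) LE.
(* The limit equation is solved for [L] using [1 - q * (1 - t) = p + q * t]. *)
have : (p + q * t) * L = p + q * t * (1 - (q * t / (p + q * t)) ^+ k).
  by move: LE; rewrite /p; lra.
move=> /(congr1 (fun z => z / (p + q * t))); rewrite mulrAC mulfV // mul1r => ->.
by rewrite exprS; field.
Qed.

End BinomialLt.

(** * Order statistics and exceedance counts *)

(** The entries at most [y] form an initial segment of a sorted list, so position [j] belongs to it
    exactly when its length exceeds [j]. *)
Lemma sorted_nth_le d (T : orderType d) (x0 y : T) (s : seq T) j :
  sorted <=%O s -> (j < size s)%N ->
  (nth x0 s j <= y)%O = (j < count (fun x => (x <= y)%O) s)%N.
Proof.
move=> ss js; apply/idP/idP => [ny|].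
  rewrite -(cat_take_drop j.+1 s) count_cat.
  apply: (leq_trans _ (leq_addr _ _)).
  suff : all (fun x => (x <= y)%O) (take j.+1 s).
    by rewrite all_count => /eqP ->; rewrite size_takel.
  apply/(all_nthP x0) => i.
  rewrite size_takel // => ij; rewrite nth_take //.
  by apply: le_trans ny; apply: le_sorted_leq_nth; rewrite ?inE// (leq_trans ij).
apply: contraTT; rewrite -ltNge -leqNgt => ny.
rewrite -(cat_take_drop j s) count_cat.
have -> : count (fun x => (x <= y)%O) (drop j s) = 0%N.
  apply/eqP; rewrite -leqn0 leqNgt -has_count; apply/(has_nthP x0) => -[i].
  rewrite size_drop nth_drop => ij; apply/negP; rewrite -ltNge.
  by apply: lt_le_trans ny _; apply: le_sorted_leq_nth; rewrite ?inE ?leq_addr// -ltn_subRL.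
by rewrite addn0 (leq_trans (count_size _ _)) // size_takel // ltnW.
Qed.

Definition exceedances (T : Type) (R : realType) (X : nat -> T -> R) (y : R)
    (r : nat) (w : T) : nat :=
  count (fun i => y < X i w) (iota 0 r).

(** Exceedances and values at most [y] partition the sample of size [r]. The hypothesis keeps the
    index away from the default value of [nth]. *)
Lemma order_stat_le (T : Type) (R : realType) (X : nat -> T -> R) (y : R)
    j r w : (j.-1 < r)%N ->
  (order_stat X j r w <= y) = (exceedances X y r w < r - j.-1)%N.
Proof.
move=> jr; rewrite /order_stat sorted_nth_le ?sort_le_sorted//; last first.
  by rewrite size_sort size_mkseq.
rewrite count_sort /mkseq count_map /exceedances.
have := count_predC (fun i => y < X i w) (iota 0 r); rewrite size_iota.
rewrite (@eq_count _ (predC _) (preim (fun i => X i w) (fun x => x <= y))).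
  by move=> rE; rewrite ltn_subRL addnC -[X in _ = (_ < X)%N]rE ltn_add2l.
by move=> i /=; rewrite -leNgt.
Qed.

(** * Law of the exceedance counts of independent observations *)

Section Exceedances.
Context d (T : measurableType d) (R : realType) (P : probability T R).
Variables (X : nat -> {RV P >-> R}) (y : R).

Let few r k := [set w | (exceedances X y r w < k)%N].

Let few_eq0 r : few r 0 = set0.
Proof. by apply/seteqP; split. Qed.

Let few0 k : few 0 k.+1 = setT.
Proof. by apply/seteqP; split. Qed.

(** Splitting on the last observation mirrors the two terms in the recursion of [binomial_lt]. *)
Let few_succ r k : few r.+1 k.+1 =
  (few r k.+1 `&` X r @^-1` `]-oo, y]) `|` (few r k `&` X r @^-1` `]y, +oo[).
Proof.
rewrite /few /exceedances -[in iota _ r.+1]addn1 iotaD.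
apply/seteqP; split=> w /=; rewrite count_cat /=
  !in_itv /= andbT add0n addn0 leNgt; case: (y < X r w) => /=.
- by rewrite addn1 ltnS => ?; right.
- by rewrite addn0 => ?; left.
- by rewrite addn1 ltnS => -[[]|[]].
- by rewrite addn0 => -[[]|[]].
Qed.

(** Independence of the sample size is available only for events of [sigma_family X], hence this
    sharper form of measurability. *)
Lemma sigma_family_exceedances_lt r k :
  sigma_family X [set w | (exceedances X y r w < k)%N].
Proof.
pose G := \bigcup_i preimage_set_system setT (X i) measurable.
(* Equipping [T] with the generated sigma-algebra makes the closure lemmas for measurable sets apply
   to [sigma_family X]. *)
pose U : measurableType _ := g_sigma_algebraType G.
have mX i (C : set R) : measurable C -> measurable (X i @^-1` C : set U).
  move=> mC; apply: sub_sigma_algebra; exists i => //.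
  by exists C => //; rewrite setTI.
rewrite -/(few r k); elim: r k => [|r IH] [|k]; rewrite ?few_eq0 ?few0.
- exact: (@measurable0 _ U).
- exact: (@measurableT _ U).
- exact: (@measurable0 _ U).
rewrite few_succ; apply: (@measurableU _ U); apply: (@measurableI _ U).
- exact: IH.
- exact: mX.
- exact: IH.
- exact: mX.
Qed.

Lemma sigma_family_order_stat_le j r :
  sigma_family X [set w | order_stat X j r w <= y].
Proof.
pose G := \bigcup_i preimage_set_system setT (X i) measurable.
pose U : measurableType _ := g_sigma_algebraType G.
have [jr|rj] := ltnP j.-1 r.
  under eq_set do rewrite order_stat_le//.
  exact: sigma_family_exceedances_lt.
(* Out of range, [order_stat] is the constant 0, so the event is everything or empty according to
   the sign of [y]. *)
rewrite /order_stat; under eq_set do rewrite nth_default ?size_sort ?size_mkseq//.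
case: (0 <= y).
  have -> : [set _ : T | true] = setT by apply/seteqP; split.
  exact: (@measurableT _ U).
have -> : [set _ : T | false] = set0 by apply/seteqP; split.
exact: (@measurable0 _ U).
Qed.

Lemma sigma_family_measurable B : sigma_family X B -> measurable B.
Proof.
apply: smallest_sub; first exact: sigma_algebra_measurable.
by move=> C [i _ [A mA <-]]; exact: (measurable_funPT (X i)).
Qed.

Hypothesis X_indep : mutually_independent X.
Variable t : R.
Hypothesis X_le : forall i, P (X i @^-1` `]-oo, y]) = (1 - t)%:E.

Let X_gt i : P (X i @^-1` `]y, +oo[) = t%:E.
Proof.
have -> : X i @^-1` `]y, +oo[ = ~` (X i @^-1` `]-oo, y]).
  by rewrite preimage_setC; congr (_ @^-1` _); rewrite setCitvl.
rewrite probability_setC ?X_le; last exact: measurable_funPTI.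
by rewrite -EFinB; congr EFin; ring.
Qed.

(** Mutual independence speaks only of finite intersections of preimages. Carrying arbitrary events
    on observations of index at least [r] strengthens the induction: the step moves observation [r]
    from the count into [J]. *)
Lemma exceedances_lt_indep r k (J : {fset nat}) (A : nat -> set R) :
  (forall i, measurable (A i)) -> (forall i, i \in J -> (r <= i)%N) ->
  P ([set w | (exceedances X y r w < k)%N] `&`
     \bigcap_(i in [set` J]) X i @^-1` A i) =
  ((binomial_lt t r k)%:E * \big[*%E/1%E]_(i <- J) P (X i @^-1` A i))%E.
Proof.
rewrite -/(few r k); elim: r k J A => [|r IH] [|k] J A mA rJ.
- by rewrite few_eq0 set0I measure0 mul0e.
- by rewrite few0 setTI mul1e X_indep.
- by rewrite few_eq0 set0I measure0 mul0e.
(* [A1 C] prescribes [C] at the new index [r] and agrees with [A] on [J]. *)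
pose A1 C i := if i == r then C else A i.
have mA1 C i : measurable C -> measurable (A1 C i) by rewrite /A1; case: ifP.
have rNJ : r \notin J by apply/negP => /rJ; rewrite ltnn.
have capE C : \bigcap_(i in [set` (r |` J)%fset]) X i @^-1` A1 C i =
    X r @^-1` C `&` \bigcap_(i in [set` J]) X i @^-1` A i.
  rewrite set_fsetU1 bigcap_setU1 /A1 eqxx; congr (_ `&` _).
  apply: eq_bigcapr => i /= iJ; case: eqP => // ir.
  by rewrite -ir iJ in rNJ.
have prodE C : (\big[*%E/1%E]_(i <- (r |` J)%fset) P (X i @^-1` A1 C i) =
    P (X r @^-1` C) * \big[*%E/1%E]_(i <- J) P (X i @^-1` A i))%E.
  rewrite big_fsetU1 //= {1}/A1 eqxx; congr (_ * _)%E.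
  apply: eq_big_seq => i iJ; rewrite /A1; case: eqP => // ir.
  by rewrite -ir iJ in rNJ.
have J'r i : i \in (r |` J)%fset -> (r <= i)%N.
  by rewrite !inE => /orP[/eqP ->//|/rJ/ltnW].
have mfew s l : measurable (few s l).
  by apply: sigma_family_measurable; exact: sigma_family_exceedances_lt.
have mcap : measurable (\bigcap_(i in [set` J]) X i @^-1` A i).
  by apply: fin_bigcap_measurable => // i _; exact: measurable_funPTI.
have step l C : measurable C ->
    (P (few r l `&` (X r @^-1` C `&` \bigcap_(i in [set` J]) X i @^-1` A i)) =
    (binomial_lt t r l)%:E *
      (P (X r @^-1` C) * \big[*%E/1%E]_(i <- J) P (X i @^-1` A i)))%E.
  move=> mC; rewrite -capE -prodE; apply: IH => // i; exact: mA1.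
have PU (C D : set T) : measurable C -> measurable D -> C `&` D = set0 ->
    (P (C `|` D) = P C + P D)%E by exact: measureU.
rewrite few_succ setIUl PU.
- rewrite -!setIA !step // X_le X_gt !muleA -!EFinM -muleDl//=.
  + by congr (_ * _)%E; rewrite -EFinD; congr EFin; ring.
  + apply: prode_fin_num => i _.
    by rewrite fin_num_measure //; exact: measurable_funPTI.
- by do 2! [apply: measurableI => //]; exact: measurable_funPTI.
- by do 2! [apply: measurableI => //]; exact: measurable_funPTI.
- apply/seteqP; split=> // w [[[_ /= +] _] [[_ /= +] _]].
  by rewrite !in_itv /= andbT leNgt => /negP.
Qed.

Lemma probability_exceedances_lt r k :
  P [set w | (exceedances X y r w < k)%N] = (binomial_lt t r k)%:E.
Proof.
have := @exceedances_lt_indep r k fset0 (fun=> setT) (fun=> measurableT).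
by rewrite set_fset0 bigcap_set0 setIT big_seq_fset0 mule1; apply.
Qed.

End Exceedances.

(** * Bounds for one shifted geometric sample size *)

Section GeometricSample.
Context d (T : measurableType d) (R : realType) (P : probability T R).
Variables (X : nat -> {RV P >-> R}) (N : {RV P >-> nat}) (y t q : R) (m k : nat).
Hypotheses (t01 : 0 <= t <= 1) (q01 : 0 < q < 1) (hk : (1 <= k <= m)%N).
Hypothesis X_indep : mutually_independent X.
Hypothesis X_le : forall i, P (X i @^-1` `]-oo, y]) = (1 - t)%:E.
Hypothesis N_indep : independent_of_family N X.
Hypothesis N_geom : forall r, (m <= r)%N ->
  P [set w | N w = r] = ((1 - q) * q ^+ (r - m))%:E.

Let mN r : measurable [set w | N w = r].
Proof. by rewrite -[mkset _]/(N @^-1` [set r]); exact: measurable_funPTI. Qed.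

(* The masses prescribed on [m, oo[ already add up to 1. *)
Lemma geometric_lt_eq0 r : (r < m)%N -> P [set w | N w = r] = 0%E.
Proof.
move=> rm; have /andP[q0 q1] := q01; apply/eqP; rewrite eq_le measure_ge0 andbT.
have le_q J : (fine (P [set w | N w = r]) <= q ^+ J).
  (* The event [N = r] followed by [N = m], [N = m + 1], ...: the first [J.+1] are disjoint, so P(N
     = r) + (1 - [q ^+ J]) is at most 1. *)
  pose A j := if j is j'.+1 then [set w | N w = m + j']%N else [set w | N w = r].
  have mA j : measurable (A j) by case: j => [|j]; exact: mN.
  have tA : trivIset [set: nat] A.
    move=> [|i] [|j] _ _ [w [/= wi wj]] //; move: rm.
    - by rewrite -wi wj ltnNge leq_addr.
    - by rewrite -wj wi ltnNge leq_addr.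
    - by move: wj; rewrite wi => /addnI ->.
  have : (P (\big[setU/set0]_(j < J.+1) A j) <= 1)%E.
    by apply: probability_le1; apply: bigsetU_measurable => j _; exact: mA.
  rewrite measure_bigsetU// big_ord_recl /=.
  rewrite (eq_bigr (fun j : 'I_J => ((1 - q) * q ^+ j)%:E)); last first.
    by move=> j _; rewrite N_geom ?leq_addr// addKn.
  rewrite sumEFin geom_sum.
  rewrite -[P _]fineK ?fin_num_measure// -EFinD lee_fin; lra.
rewrite -[P _]fineK ?fin_num_measure// lee_fin.
have qJ : q ^+ J @[J --> \oo] --> 0 by apply: cvg_expr; rewrite gtr0_norm.
by apply: (ler_cvg_to (cvg_cst _) qJ); exact: nearW.
Qed.

Let theta := (q * t / (1 - q + q * t)) ^+ k.

Lemma kth_largest_df_bounds : exists2 v : R,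
  kth_largest_df P X N k y = v%:E &
  (1 - t) ^+ m * (1 - theta) <= v <= 1 - theta.
Proof.
have /andP[k0 km] := hk; have /andP[q0 q1] := q01.
pose B r := [set w | order_stat X (r - k + 1) r w <= y].
have mB r : measurable (B r).
  by apply: sigma_family_measurable; exact: sigma_family_order_stat_le.
pose A r := [set w | N w = r] `&` B r.
(* The events [A r] decompose the target event by the value of [N], which reduces it to
   deterministic sample sizes. *)
have mA r : measurable (A r) by exact: measurableI.
have tA : trivIset [set: nat] A.
  by move=> i j _ _ [w [[/= <- _] [/= <- _]]].
have AE : [set w | order_stat X (N w - k + 1) (N w) w <= y] = \bigcup_r A r.
  by apply/seteqP; split=> [w ?|w [r _ [/= <-]]] //; exists (N w).
have PA r : (m <= r)%N ->
    P (A r) = ((1 - q) * q ^+ (r - m) * binomial_lt t r k)%:E.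
  move=> mr; have kr := leq_trans km mr.
  rewrite /A -[mkset _]/(N @^-1` [set r]) N_indep //; last first.
    exact: sigma_family_order_stat_le.
  rewrite N_geom // [RHS]EFinM -(probability_exceedances_lt X_indep X_le).
  (* For rank [r - k + 1] the threshold in [order_stat_le] is [r - (r - k) = k], since [k <= r];
     [0 < k] puts the rank in range. *)
  congr (_ * P _)%E; apply/seteqP; split=> w; rewrite /B /= order_stat_le;
    by rewrite addn1 ?subKn //= ltn_subrL k0 (leq_trans k0).
have PA0 r : (r < m)%N -> P (A r) = 0%E.
  move=> rm; apply/eqP; rewrite eq_le measure_ge0 andbT.
  by rewrite -(geometric_lt_eq0 rm) le_measure ?inE //; exact: subIsetl.
have mU : measurable (\bigcup_r A r) by exact: bigcup_measurable.
exists (fine (P (\bigcup_r A r))).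
  by rewrite /kth_largest_df AE fineK // fin_num_measure.
pose S J := \sum_(j < J) (1 - q) * q ^+ j * binomial_lt t (m + j) k.
have SP : S J @[J --> \oo] --> fine (P (\bigcup_r A r)).
  have : (\sum_(0 <= r < J) P (A r))%E @[J --> \oo] -->
      (fine (P (\bigcup_r A r)))%:E.
    by rewrite fineK ?fin_num_measure//; exact: measure_semi_sigma_additive.
  (* Shifting by [m] lets the null terms below [m] be split off from every partial sum. *)
  rewrite -[X in X -> _](cvg_shiftn m) /=.
  move=> /fine_cvg; apply: cvg_trans; apply: near_eq_cvg; apply: nearW => J /=.
  rewrite addnC big_mkord big_split_ord /= big1 => [|i _]; last exact: PA0.
  rewrite add0e (eq_bigr (fun j : 'I_J =>
    ((1 - q) * q ^+ j * binomial_lt t (m + j) k)%:E)) ?sumEFin//.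
  by move=> j _; rewrite PA ?leq_addr// addKn.
have lim := @cvg_geometric_binomial_lt _ _ t01 _ q01 k.
(* Both inequalities hold term by term by [binomial_lt_addl] and pass to the limit of the partial
   sums. *)
apply/andP; split.
  apply: (ler_cvg_to (cvgM (cvg_cst _) lim) SP); apply: nearW => J /=.
  rewrite mulr_sumr; apply: ler_sum => j _.
  rewrite mulrCA ler_wpM2l //; first by rewrite mulr_ge0 ?exprn_ge0 ?subr_ge0// ltW.
  by have /andP[] := binomial_lt_addl t01 m j k.
apply: (ler_cvg_to SP lim); apply: nearW => J; apply: ler_sum => j _.
rewrite ler_wpM2l //; first by rewrite mulr_ge0 ?exprn_ge0 ?subr_ge0// ltW.
by have /andP[] := binomial_lt_addl t01 m j k.
Qed.

End GeometricSample.

(** * Tail asymptotics from convergence of powers *)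

Lemma cvg0_of_cvg_natM (R : realType) (u : nat -> R) (l : R) :
  n%:R * u n @[n --> \oo] --> l -> u n @[n --> \oo] --> (0 : R).
Proof.
move=> ul; have invn : (n%:R : R)^-1 @[n --> \oo] --> 0.
  by rewrite -cvg_shiftS; exact: cvg_harmonic.
have : n%:R^-1 * (n%:R * u n) @[n --> \oo] --> 0 * l by exact: cvgM.
rewrite mul0r; apply: cvg_trans; apply: near_eq_cvg; near=> n.
rewrite mulrA mulVf ?mul1r // pnatr_eq0 -lt0n.
by near: n; exact: nbhs_infty_gt.
Unshelve. all: by end_near. Qed.

Section Tail.
Variables (R : realType) (f : nat -> R) (g : R).
Hypotheses (f01 : forall n, 0 <= f n <= 1) (g0 : 0 < g).
Hypothesis fg : f n ^+ n @[n --> \oo] --> g.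

(** Logarithms of [f n] are meaningful only eventually: a zero base would make the power 0, away
    from [g]. *)
Let f_gt0 : \forall n \near \oo, 0 < f n.
Proof.
near=> n.
have : 0 < f n ^+ n by near: n; exact: (cvgr_gt g fg).
have n0 : (0 < n)%N by near: n; exact: nbhs_infty_gt.
have /andP[+ _] := f01 n; rewrite le_eqVlt => /predU1P[<-|//].
by rewrite expr0n gtn_eqF // ltxx.
Unshelve. all: by end_near. Qed.

Let lnf : n%:R * ln (f n) @[n --> \oo] --> ln g.
Proof.
have : ln (f n ^+ n) @[n --> \oo] --> ln g.
  by apply: (@continuous_cvg _ _ _ _ _ _ (@ln R)) => //; exact: continuous_ln.
apply: cvg_trans; apply: near_eq_cvg.
apply: filterS f_gt0 => n fn0.
by rewrite /= lnXn // mulr_natl.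
Qed.

(** A finite limit of [n%:R * ln (f n)] forces [ln (f n)] to tend to 0. *)
Lemma cvg_base_of_pow : f n @[n --> \oo] --> (1 : R).
Proof.
have ln0 := cvg0_of_cvg_natM lnf.
have : expR (ln (f n)) @[n --> \oo] --> expR 0.
  by apply: (@continuous_cvg _ _ _ _ _ _ (@expR R)) => //; exact: continuous_expR.
rewrite expR0; apply: cvg_trans; apply: near_eq_cvg.
by apply: filterS f_gt0 => n fn /=; rewrite lnK.
Qed.

(* Squeeze by [1 - 1 / f <= ln f <= f - 1]. *)
Lemma cvg_tail_of_pow : n%:R * (1 - f n) @[n --> \oo] --> - ln g.
Proof.
have up : - (n%:R * ln (f n)) @[n --> \oo] --> - ln g by exact: cvgN.
have lo : - (n%:R * ln (f n)) * f n @[n --> \oo] --> - ln g.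
  by rewrite -[X in _ --> X]mulr1; apply: cvgM up cvg_base_of_pow.
apply: squeeze_cvgr lo up; apply: filterS f_gt0 => n fn.
rewrite -mulrN -mulrA; apply/andP; split; apply: ler_wpM2l => //.
  have : ln (1 + ((f n)^-1 - 1)) <= (f n)^-1 - 1.
    by apply: le_ln1Dx; rewrite ltrBDl addrN invr_gt0.
  rewrite addrC subrK lnV// => /(ler_wpM2r (ltW fn)).
  by rewrite mulrBl mulVf ?gt_eqF// mul1r.
have : ln (1 + (f n - 1)) <= f n - 1.
  by apply: le_ln1Dx; rewrite ltrBDl addrN.
by rewrite addrC subrK; lra.
Qed.

End Tail.

Lemma cvg_exprn (R : realType) (u : nat -> R) (l : R) k :
  u n @[n --> \oo] --> l -> u n ^+ k @[n --> \oo] --> l ^+ k.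
Proof.
move=> ul; apply: (@continuous_cvg _ _ _ _ _ _ (fun z : R => z ^+ k)) => //.
exact: exprn_continuous.
Qed.

(** * Passage to the limit *)

Theorem theorem4p2 (R : realType) (G : R -> R)
    (F : cumulativeBounded (0 : R) (1 : R)) (a b : nat -> R)
    (hG : max_stable G)
    (ha : forall n : nat, (0 < n)%N -> 0 < a n)
    (hF : forall x : R, F (a n * x + b n) ^+ n @[n --> \oo] --> G x)
    (m : nat) (hm : (1 <= m)%N)
    (d : measure_display) (T : measurableType d) (P : probability T R)
    (X : nat -> {RV P >-> R})
    (hXindep : mutually_independent X)
    (hXdf : forall (i : nat) (x : R), cdf (X i) x = (F x)%:E)
    (N : nat -> {RV P >-> nat})
    (hN : forall n : nat, (0 < n)%N -> independent_of_family (N n) X)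
    (p : nat -> R)
    (hp : forall n : nat, (0 < n)%N -> 0 < p n < 1)
    (hgeom : forall n r : nat, (0 < n)%N -> (m <= r)%N ->
       P [set w | N n w = r] = (p n * (1 - p n) ^+ (r - m))%:E)
    (hnp : n%:R * p n @[n --> \oo] --> (1 : R))
    (k : nat) (hk : (1 <= k <= m)%N) (x : R) (hx : 0 < G x) :
  kth_largest_df P X (N n) k (a n * x + b n) @[n --> \oo] -->
    (1 - (- ln (G x) / (1 - ln (G x))) ^+ k)%:E.

Proof.
pose f n := F (a n * x + b n).
have F01 y : 0 <= F y <= 1.
  by rewrite -!lee_fin -(hXdf 0%N y) measure_ge0 probability_le1.
have f01 n : 0 <= f n <= 1 by exact: F01.
have fG : f n ^+ n @[n --> \oo] --> G x by exact: hF.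
have f1 := @cvg_base_of_pow _ f _ f01 hx fG.
have ntail := @cvg_tail_of_pow _ f _ f01 hx fG.
(* Nonnegativity is inherited from the tails; it makes the limiting denominator [1 - ln (G x)]
   positive. *)
have lnG : 0 <= - ln (G x).
  apply: (ler_cvg_to (cvg_cst 0) ntail); apply: nearW => n.
  by rewrite mulr_ge0 // subr_ge0; have /andP[] := f01 n.
have p0 := cvg0_of_cvg_natM hnp.
pose q n := 1 - p n.
have q1 : q n @[n --> \oo] --> (1 : R).
  by rewrite -[X in _ --> X](subr0 1); apply: cvgB p0; exact: cvg_cst.
pose theta n := q n * (1 - f n) / (1 - q n + q n * (1 - f n)).
have theta_lim : theta n @[n --> \oo] --> - ln (G x) / (1 - ln (G x)).
  have qt : q n * (n%:R * (1 - f n)) @[n --> \oo] --> - ln (G x).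
    by rewrite -[X in _ --> X]mul1r; exact: cvgM.
  have den0 : 1 + - ln (G x) != 0 by rewrite gt_eqF// ltr_pwDl.
  (* Numerator and denominator of [theta n] both tend to 0; multiplying each by [n] gives finite
     limits, the one below being nonzero. *)
  have : q n * (n%:R * (1 - f n)) / (n%:R * p n + q n * (n%:R * (1 - f n)))
      @[n --> \oo] --> - ln (G x) / (1 - ln (G x)).
    by apply: cvgM => //; apply: cvgV => //; exact: cvgD.
  apply: cvg_trans; apply: near_eq_cvg; near=> n.
  have n0 : (n%:R : R) != 0.
    by rewrite pnatr_eq0 -lt0n; near: n; exact: nbhs_infty_gt.
  have -> : n%:R * p n + q n * (n%:R * (1 - f n)) =
      n%:R * (1 - q n + q n * (1 - f n)) by rewrite /q; ring.
  by rewrite mulrCA invfM mulrACA mulfV // mul1r.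
have bounds n : (0 < n)%N -> exists2 v : R,
    kth_largest_df P X (N n) k (a n * x + b n) = v%:E &
    f n ^+ m * (1 - theta n ^+ k) <= v <= 1 - theta n ^+ k.
  move=> n0; have /andP[p_gt0 p_lt1] := hp n n0.
  (* Exposes the exceedance probability [t = 1 - f n]. *)
  rewrite -[f n](subKr 1).
  apply: kth_largest_df_bounds => //.
  - by have := f01 n; lra.
  - by rewrite /q; lra.
  - by move=> i; rewrite subKr; exact: hXdf.
  - exact: hN.
  - by move=> r mr; rewrite subKr hgeom.
have hi : 1 - theta n ^+ k @[n --> \oo] --> 1 - (- ln (G x) / (1 - ln (G x))) ^+ k.
  by apply: cvgB; [exact: cvg_cst|exact: cvg_exprn].
(* The factor [f n ^+ m] tends to 1 because [m] is fixed, so both bounds share one limit. *)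
have lo : f n ^+ m * (1 - theta n ^+ k) @[n --> \oo] -->
    1 - (- ln (G x) / (1 - ln (G x))) ^+ k.
  rewrite -[X in _ --> X]mul1r; apply: cvgM hi.
  by rewrite -(expr1n R m); exact: cvg_exprn.
apply: cvg_EFin.
  near=> n; have /bounds[v -> _] : (0 < n)%N by near: n; exact: nbhs_infty_gt.
  by [].
apply: squeeze_cvgr lo hi; near=> n.
have /bounds[v /= -> //] : (0 < n)%N by near: n; exact: nbhs_infty_gt.
Unshelve. all: by end_near. Qed.
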